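(* Let $\alpha\neq0$ be a real number. Any rotational timelike $K^\alpha$-translator with timelike axis, normalized so that the axis is the $z$-axis and the speed is $\vec v=(0,0,1)$, is parametrized by $X(r,\theta)=(r\cos\theta,r\sin\theta,f(r))$, where $$f(r)=\begin{cases}\pm\displaystyle\int^r\Big(1+\frac1{m^2}e^{-t^2}\Big)^{1/2}dt,\quad m>0, & \alpha=\frac12,\\[2mm] \pm\displaystyle\int^r\Big(1+\Big(m+\frac{2\alpha-1}{2\alpha}t^2\Big)^{\frac{2\alpha}{1-2\alpha}}\Big)^{1/2}dt,\quad m\in\mathbb R, & \alpha\neq\frac12.\end{cases}$$ The maximal domain of $f(r)$ is: 1. Case $\alpha=1/2$: $(0,\infty)$. 2. Case $\alpha\in(0,1/2)$: then $m>0$ and the domain is $\Big(0,\sqrt{\frac{2\alpha}{1-2\alpha}m}\Big)$. 3. Case $\alpha\notin[0,1/2]$: $(0,\infty)$ if $m\ge0$, or $\Big(\sqrt{\frac{2\alpha}{1-2\alpha}m},\infty\Big)$ if $m<0$.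
   Context: $\mathbb R_1^3$ is $\mathbb R^3$ with the metric $\langle,\rangle=dx^2+dy^2-dz^2$. A surface is timelike if its induced metric is Lorentzian; then its (local) unit normal $N$ satisfies $\langle N,N\rangle=\epsilon=1$. The Gauss curvature is $K=\epsilon\det(A)$, where $AU=-\nabla^0_U N$ is the Weingarten map and $\nabla^0$ is the Levi-Civita connection of $\mathbb R_1^3$. In a local parametrization $X(u,v)$, $$K=-\frac{\det(X_u,X_v,X_{uu})\det(X_u,X_v,X_{vv})-\det(X_u,X_v,X_{uv})^2}{(EG-F^2)^2},$$ where $E=\langle X_u,X_u\rangle$, $F=\langle X_u,X_v\rangle$, $G=\langle X_v,X_v\rangle$. A timelike surface is a timelike $K^\alpha$-translator with speed $\vec v$ if $K>0$ and $K^\alpha=\langle N,\vec v\rangle$ everywhere, for a choice of unit normal $N$. A surface of revolution whose axis is the $z$-axis is one parametrized by $X(r,\theta)=(r\cos\theta,r\sin\theta,f(r))$ with $f$ smooth on an interval of $r>0$; it is timelike iff $f'^2>1$. The symbol $\int^r$ denotes an antiderivative (defined up to an additive constant), and $m$ is a constant of integration. The maximal domain of $f$ is the largest open interval in $(0,\infty)$ on which the formula defines a smooth function for which $X$ is timelike with $K>0$ and satisfies the translator equation; only the values of $m$ listed give a nonempty domain. *)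

(* Defs.v *)
From Stdlib Require Export Reals.
From Coquelicot Require Export Coquelicot.
Open Scope R_scope.

(* ---------- Lorentz-Minkowski space ---------- *)

Record V3 : Type := vec { vx : R; vy : R; vz : R }.

Definition lor (U W : V3) : R := vx U * vx W + vy U * vy W - vz U * vz W.

Definition vadd (U W : V3) : V3 := vec (vx U + vx W) (vy U + vy W) (vz U + vz W).
Definition vscal (a : R) (U : V3) : V3 := vec (a * vx U) (a * vy U) (a * vz U).
Definition vopp (U : V3) : V3 := vscal (-1) U.

Definition vderive (c : R -> V3) (t : R) : V3 :=
  vec (Derive (fun s => vx (c s)) t)
      (Derive (fun s => vy (c s)) t)
      (Derive (fun s => vz (c s)) t).

Definition vder1 (X : R -> R -> V3) (u v : R) : V3 := vderive (fun t => X t v) u.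
Definition vder2 (X : R -> R -> V3) (u v : R) : V3 := vderive (fun t => X u t) v.

(* ---------- Parametrized surfaces on an open set D of the (u,v)-plane ---------- *)

Definition smooth2 (D : R -> R -> Prop) (g : R -> R -> R) : Prop :=
  forall (n : nat) (u v : R), D u v -> ex_diff_n g n u v.

Definition vsmooth2 (D : R -> R -> Prop) (X : R -> R -> V3) : Prop :=
  smooth2 D (fun u v => vx (X u v)) /\
  smooth2 D (fun u v => vy (X u v)) /\
  smooth2 D (fun u v => vz (X u v)).

Definition tangent (X : R -> R -> V3) (u v a b : R) : V3 :=
  vadd (vscal a (vder1 X u v)) (vscal b (vder2 X u v)).

(* The induced metric has signature (1,1).  An orthonormal pair of tangent
   vectors is linearly independent, so this also says that X is an immersion
   at (u,v). *)
Definition lorentzian_at (X : R -> R -> V3) (u v : R) : Prop :=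
  exists a b c d : R,
    let P := tangent X u v a b in
    let Q := tangent X u v c d in
    lor P P = 1 /\ lor Q Q = -1 /\ lor P Q = 0.

Definition timelike_surface (D : R -> R -> Prop) (X : R -> R -> V3) : Prop :=
  vsmooth2 D X /\ forall u v, D u v -> lorentzian_at X u v.

Definition unit_normal (D : R -> R -> Prop) (X N : R -> R -> V3) : Prop :=
  vsmooth2 D N /\
  forall u v, D u v ->
    lor (N u v) (N u v) = 1 /\
    lor (N u v) (vder1 X u v) = 0 /\
    lor (N u v) (vder2 X u v) = 0.

(* (a, c; b, d) is the matrix, in the basis (X_u, X_v), of the Weingarten map
   A U = - nabla^0_U N; the flat connection gives nabla^0_{X_u} N = N_u. *)
Definition weingarten (X N : R -> R -> V3) (u v a b c d : R) : Prop :=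
  vopp (vder1 N u v) = tangent X u v a b /\
  vopp (vder2 N u v) = tangent X u v c d.

(* K = epsilon det A with epsilon = <N,N>. *)
Definition gauss_curvature (X N : R -> R -> V3) (u v K : R) : Prop :=
  exists a b c d : R,
    weingarten X N u v a b c d /\ K = lor (N u v) (N u v) * (a * d - b * c).

Definition timelike_translator
    (alpha : R) (speed : V3) (D : R -> R -> Prop) (X : R -> R -> V3) : Prop :=
  timelike_surface D X /\
  exists N : R -> R -> V3,
    unit_normal D X N /\
    forall u v, D u v ->
      exists K : R,
        gauss_curvature X N u v K /\ 0 < K /\ Rpower K alpha = lor (N u v) speed.

(* ---------- Surfaces of revolution about the z-axis ---------- *)

Definition itv (a b : Rbar) (r : R) : Prop := Rbar_lt a r /\ Rbar_lt r b.

Definition pos_interval (a b : Rbar) : Prop := Rbar_le 0 a /\ Rbar_lt a b.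

Definition smooth_on (a b : Rbar) (f : R -> R) : Prop :=
  forall (n : nat) (r : R), itv a b r -> ex_derive_n f n r.

Definition revolution (f : R -> R) (r theta : R) : V3 :=
  vec (r * cos theta) (r * sin theta) (f r).

Definition rotational_translator (alpha : R) (a b : Rbar) (f : R -> R) : Prop :=
  smooth_on a b f /\
  timelike_translator alpha (vec 0 0 1) (fun r _ => itv a b r) (revolution f).

(* ---------- The explicit profile ---------- *)

(* is_power b p y: the real power b^p is defined and equal to y.  This is a
   relation because Rpower has an arbitrary value at b <= 0, while the base in
   the profile formula can be nonpositive and its exponent can be an integer. *)
Inductive is_power (b p : R) : R -> Prop :=
| power_pos : 0 < b -> is_power b p (Rpower b p)
| power_zero : b = 0 -> 0 < p -> is_power b p 0
| power_int (k : Z) : p = IZR k -> b <> 0 -> is_power b p (powerRZ b k).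

(* The integrand of the profile is sqrt (1 + y). *)
Definition profile_term (alpha m t y : R) : Prop :=
  (alpha = 1 / 2 /\ y = 1 / m ^ 2 * exp (- t ^ 2)) \/
  (alpha <> 1 / 2 /\
   is_power (m + (2 * alpha - 1) / (2 * alpha) * t ^ 2)
            (2 * alpha / (1 - 2 * alpha)) y).

Definition is_sign (s : R) : Prop := s = 1 \/ s = -1.

Definition constant_range (alpha m : R) : Prop := alpha = 1 / 2 -> 0 < m.

(* On (a,b) the integrand is defined and f is s times an antiderivative of it. *)
Definition is_profile (alpha s m : R) (a b : Rbar) (f : R -> R) : Prop :=
  forall r, itv a b r ->
    exists y, profile_term alpha m r y /\ 0 <= 1 + y /\
              is_derive f r (s * sqrt (1 + y)).

(* The formula determines f on (a,b) only up to an additive constant, hence the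
   quantification over all the functions f it defines. *)
Definition profile_domain (alpha s m : R) (a b : Rbar) : Prop :=
  pos_interval a b /\
  (exists f, is_profile alpha s m a b f) /\
  (forall f, is_profile alpha s m a b f -> rotational_translator alpha a b f).

Definition maximal_domain (alpha s m : R) (a b : Rbar) : Prop :=
  profile_domain alpha s m a b /\
  forall c d, profile_domain alpha s m c d -> Rbar_le a c /\ Rbar_le d b.

(* Main.v *)
(* The positivity of K^alpha = <N,(0,0,1)> forces N = -sqrt p (f' cos, f' sin, 1)
   with p = 1/(f'^2-1), and the Weingarten map of a surface of revolution is
   diagonal with det A = p'/(2r).  The translator equation is therefore
   p' = 2 r p^(1/(2 alpha)), which integrates to p = m^2 exp(r^2) when
   alpha = 1/2 and to p^((2 alpha-1)/(2 alpha)) = m + (2 alpha-1)/(2 alpha) r^2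
   otherwise.  The maximal domain is the set of r > 0 at which the right-hand
   side of the latter is positive. *)

Require Import Defs.
From Stdlib Require Import Reals.
From Coquelicot Require Import Coquelicot.
From Stdlib Require Import Psatz Classical FunctionalExtensionality Ranalysis5.
Open Scope R_scope.

(** * Intervals *)

(** The quantity p is the square of the z-coordinate of the normal, hence K^(2 alpha); this is why K
    = p^(1/(2 alpha)) closes the equation in p alone. The equation is separable, and the exponent 1
    - 1/(2 alpha) of its integral vanishes exactly at alpha = 1/2, whence the case split. Since f'^2
    - 1 = 1/p, the exponent in the profile is the negative reciprocal of that one. The delicate
    point is maximality. [is_power] also gives values at a negative base when the exponent is an
    integer, so nothing in [profile_domain] confines an interval to the positivity set of the base.
    The remedy is to feed a profile back into the necessary direction: as a translator it has a
    first integral of its own, with a positive base, and the two constants can be compared. *)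

Lemma itv_locally (a b : Rbar) (r : R) : itv a b r -> locally r (itv a b).
Proof.
  intros [Ha Hb].
  apply filter_and; [ now apply open_Rbar_gt | now apply open_Rbar_lt ].
Qed.

Lemma itv_between (a b : Rbar) (x y t : R) :
  itv a b x -> itv a b y -> x <= t <= y -> itv a b t.
Proof.
  intros [Hx _] [_ Hy] Ht; split.
  - apply Rbar_lt_le_trans with x; [ exact Hx | apply Ht ].
  - apply Rbar_le_lt_trans with y; [ apply Ht | exact Hy ].
Qed.

Lemma itv_inhabited (a b : Rbar) : Rbar_lt a b -> exists r, itv a b r.
Proof.
  unfold itv; destruct a as [a| |], b as [b| |]; simpl; intros H; try easy.
  - exists ((a + b) / 2); lra.
  - exists (a + 1); split; [ lra | easy ].
  - exists (b - 1); split; [ easy | lra ].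
  - now exists 0.
Qed.

(** If an endpoint stuck out, the gap between the two endpoints would contain points of the smaller
    interval outside the larger. This turns inclusion of domains into the endpoint inequalities of
    [maximal_domain]. *)
Lemma itv_subset (a b c d : Rbar) :
  Rbar_lt c d -> (forall r, itv c d r -> itv a b r) ->
  Rbar_le a c /\ Rbar_le d b.
Proof.
  intros Hcd Hsub.
  destruct (itv_inhabited c d Hcd) as [r0 Hr0].
  destruct (Hsub r0 Hr0) as [Har0 Hr0b].
  split; apply Rbar_not_lt_le; intros H.
  - destruct (itv_inhabited c a H) as [t [Hct Hta]].
    assert (Hin : itv c d t).
    { split; [ exact Hct | ].
      apply Rbar_lt_trans with a; [ exact Hta | ].
      apply Rbar_lt_trans with r0; [ exact Har0 | apply Hr0 ]. }
    apply (Rbar_lt_not_le _ _ Hta), Rbar_lt_le, (Hsub t Hin).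
  - destruct (itv_inhabited b d H) as [t [Hbt Htd]].
    assert (Hin : itv c d t).
    { split; [ | exact Htd ].
      apply Rbar_lt_trans with r0; [ apply Hr0 | ].
      apply Rbar_lt_trans with b; [ exact Hr0b | exact Hbt ]. }
    apply (Rbar_lt_not_le _ _ Hbt), Rbar_lt_le, (Hsub t Hin).
Qed.

Lemma pos_interval_pos (a b : Rbar) (r : R) :
  pos_interval a b -> itv a b r -> 0 < r.
Proof.
  intros [H0 _] [Ha _]; exact (Rbar_le_lt_trans _ _ _ H0 Ha).
Qed.

Lemma eq_on_itv (a b : Rbar) (g : R -> R) :
  (forall r, itv a b r -> is_derive g r 0) ->
  forall x y, itv a b x -> itv a b y -> g x = g y.
Proof.
  intros Hg.
  assert (Hlt : forall x y, itv a b x -> itv a b y -> x < y -> g x = g y).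
  { intros x y Hx Hy Hxy; apply eq_is_derive; [ | exact Hxy ].
    intros t Ht; apply Hg, (itv_between a b x y); auto. }
  intros x y Hx Hy; destruct (Rtotal_order x y) as [H|[->|H]]; auto.
  symmetry; auto.
Qed.

Lemma sign_on_itv (a b : Rbar) (g : R -> R) :
  (forall r, itv a b r -> continuous g r) ->
  (forall r, itv a b r -> g r <> 0) ->
  exists s, is_sign s /\ forall r, itv a b r -> 0 < s * g r.
Proof.
  intros Hc Hn0.
  destruct (classic (exists x, itv a b x /\ 0 < g x)) as [[x [Hx Hgx]]|Hno].
  - exists 1; split; [ now left | ]; intros y Hy; rewrite Rmult_1_l.
    destruct (Rtotal_order (g y) 0) as [Hgy|[Hgy|Hgy]]; [ exfalso | now destruct (Hn0 y) | exact Hgy ].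
    (* [IVT_interv] wants a change from negative to positive, so it is applied to [g] or to its
       opposite according to the order of [x] and [y]. *)
    assert (Hc' : forall h, (h = g \/ h = (fun t => - g t)) -> forall r, itv a b r -> continuity_pt h r).
    { intros h [-> | ->] r Hr; apply continuity_pt_filterlim.
      - now apply Hc.
      - apply (continuous_opp g), Hc, Hr. }
    destruct (Rtotal_order x y) as [Hxy|[->|Hxy]]; [ | lra | ].
    + destruct (IVT_interv (fun t => - g t) x y) as [z [Hz Hgz]]; try lra.
      * intros t Ht; apply (Hc' _ (or_intror eq_refl)), (itv_between a b x y); auto.
      * apply (Hn0 z); [ apply (itv_between a b x y); auto | lra ].
    + destruct (IVT_interv g y x) as [z [Hz Hgz]]; try lra.
      * intros t Ht; apply (Hc' _ (or_introl eq_refl)), (itv_between a b y x); auto.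
      * apply (Hn0 z); [ apply (itv_between a b y x); auto | lra ].
  - exists (-1); split; [ now right | ]; intros y Hy.
    destruct (Rtotal_order (g y) 0) as [Hgy|[Hgy|Hgy]]; [ lra | now destruct (Hn0 y) | ].
    destruct Hno; eauto.
Qed.

(** * Smooth functions *)

(** By induction, each iterated derivative agrees on the open interval with a member of [P].
    Smoothness of products and composites then needs no formula for their higher derivatives. *)
Lemma smooth_on_closed_class (a b : Rbar) (P : (R -> R) -> Prop) :
  (forall g, P g -> exists g', P g' /\ forall r, itv a b r -> is_derive g r (g' r)) ->
  forall g, P g -> smooth_on a b g.
Proof.
  intros HP.
  assert (H : forall n g, P g -> exists h, P h /\ forall r, itv a b r -> Derive_n g n r = h r).
  { induction n as [|n IH]; intros g Hg; [ now exists g | ].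
    destruct (IH g Hg) as [h [Hh Eh]].
    destruct (HP h Hh) as [h' [Hh' Dh]].
    exists h'; split; [ exact Hh' | ]; intros r Hr; simpl.
    rewrite (Derive_ext_loc _ h); [ apply is_derive_unique, Dh, Hr | ].
    eapply filter_imp; [ | apply (itv_locally a b r Hr) ]; exact Eh. }
  intros g Hg [|n] r Hr; [ easy | ]; simpl.
  destruct (H n g Hg) as [h [Hh Eh]].
  destruct (HP h Hh) as [h' [Hh' Dh]].
  apply ex_derive_ext_loc with h.
  - eapply filter_imp; [ | apply (itv_locally a b r Hr) ].
    intros t Ht; symmetry; now apply Eh.
  - exists (h' r); now apply Dh.
Qed.

Lemma smooth_on_Derive (a b : Rbar) (f : R -> R) :
  smooth_on a b f -> smooth_on a b (Derive f).
Proof.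
  intros Hf [|n] r Hr; [ easy | ]; simpl.
  apply ex_derive_ext with (Derive_n f (S n)); [ | exact (Hf (S (S n)) r Hr) ].
  intros t; rewrite <- Nat.add_1_r; symmetry; apply (Derive_n_comp f n 1).
Qed.

Lemma smooth_on_is_derive (a b : Rbar) (f : R -> R) (r : R) :
  smooth_on a b f -> itv a b r -> is_derive f r (Derive f r).
Proof. intros Hf Hr; apply Derive_correct, (Hf 1%nat r Hr). Qed.

Lemma smooth_on_primitive (a b : Rbar) (f g : R -> R) :
  smooth_on a b g -> (forall r, itv a b r -> is_derive f r (g r)) ->
  smooth_on a b f.
Proof.
  intros Hg Hf.
  (* Adjoining [f] to the smooth functions keeps the class closed, because its derivative [g] is
     already there. *)
  apply (smooth_on_closed_class a b (fun h => h = f \/ smooth_on a b h)); [ | now left ].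
  intros h [-> | Hh].
  - exists g; auto.
  - exists (Derive h); split; [ right; now apply smooth_on_Derive | ].
    intros r Hr; now apply (smooth_on_is_derive a b).
Qed.

Lemma is_derive_Rpower (g : R -> R) (p x dg : R) :
  0 < g x -> is_derive g x dg ->
  is_derive (fun t => Rpower (g t) p) x (p * Rpower (g x) (p - 1) * dg).
Proof.
  intros Hg Dg.
  replace (p * _ * dg) with (scal dg (p * Rpower (g x) (p - 1)))
    by (unfold scal; simpl; unfold mult; simpl; ring).
  apply (is_derive_comp (fun y => Rpower y p)); [ | exact Dg ].
  now apply is_derive_Reals, derivable_pt_lim_power.
Qed.

(* Closed under differentiation, hence made of smooth functions. *)
Inductive elementary (a b : Rbar) : (R -> R) -> Prop :=
| el_smooth g : smooth_on a b g -> elementary a b g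
| el_plus g h : elementary a b g -> elementary a b h ->
    elementary a b (fun t => g t + h t)
| el_mult g h : elementary a b g -> elementary a b h ->
    elementary a b (fun t => g t * h t)
| el_exp g : elementary a b g -> elementary a b (fun t => exp (g t))
| el_Rpower g p : (forall r, itv a b r -> 0 < g r) -> elementary a b g ->
    elementary a b (fun t => Rpower (g t) p).

Lemma smooth_on_const (a b : Rbar) (c : R) : smooth_on a b (fun _ => c).
Proof. intros n r _; apply ex_derive_n_const. Qed.

Lemma smooth_on_id (a b : Rbar) : smooth_on a b (fun t => t).
Proof.
  apply (smooth_on_primitive a b _ (fun _ => 1)); [ apply smooth_on_const | ].
  intros r _; apply (is_derive_id r).
Qed.

Lemma smooth_on_elementary (a b : Rbar) (g : R -> R) :
  elementary a b g -> smooth_on a b g.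
Proof.
  apply smooth_on_closed_class; clear g.
  intros g; induction 1 as [g Hg | g h _ [g' [Eg Dg]] _ [h' [Eh Dh]]
    | g h Hg [g' [Eg Dg]] Hh [h' [Eh Dh]] | g Hg [g' [Eg Dg]] | g p Hpos Hg [g' [Eg Dg]]].
  - exists (Derive g); split; [ now apply el_smooth, smooth_on_Derive | ].
    intros r Hr; now apply (smooth_on_is_derive a b).
  - exists (fun t => g' t + h' t); split; [ now apply el_plus | ].
    intros r Hr; apply (is_derive_plus g h); auto.
  - exists (fun t => g' t * h t + g t * h' t); split.
    { apply el_plus; apply el_mult; assumption. }
    intros r Hr; apply (is_derive_mult g h); auto; apply Rmult_comm.
  - exists (fun t => g' t * exp (g t)); split.
    { apply el_mult; [ | apply el_exp ]; assumption. }
    intros r Hr; apply (is_derive_comp exp g); [ apply is_derive_exp | auto ].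
  - exists (fun t => p * Rpower (g t) (p - 1) * g' t); split.
    { apply el_mult; [ apply el_mult | exact Eg ].
      - apply el_smooth, smooth_on_const.
      - now apply el_Rpower. }
    intros r Hr; apply is_derive_Rpower; auto.
Qed.

Lemma smooth_on_ext (a b : Rbar) (g h : R -> R) :
  (forall r, itv a b r -> g r = h r) -> smooth_on a b g -> smooth_on a b h.
Proof.
  intros E Hg n r Hr; apply ex_derive_n_ext_loc with g; [ | now apply Hg ].
  eapply filter_imp; [ | apply (itv_locally a b r Hr) ]; exact E.
Qed.

Lemma smooth_cos_sin (A B : R) :
  smooth_on m_infty p_infty (fun t => A * cos t + B * sin t).
Proof.
  apply (smooth_on_closed_class _ _
    (fun h => exists A B, h = fun t => A * cos t + B * sin t)); [ | now exists A, B ].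
  intros h [C [D ->]].
  exists (fun t => D * cos t + (- C) * sin t); split; [ now exists D, (- C) | ].
  intros r _; auto_derive; [ easy | ring ].
Qed.

Lemma smooth_cos : smooth_on m_infty p_infty cos.
Proof.
  eapply smooth_on_ext; [ | apply (smooth_cos_sin 1 0) ]; intros; simpl; ring.
Qed.

Lemma smooth_sin : smooth_on m_infty p_infty sin.
Proof.
  eapply smooth_on_ext; [ | apply (smooth_cos_sin 0 1) ]; intros; simpl; ring.
Qed.

(** Both partial derivatives of a separated product are separated products again, so the induction
    on the order runs over all [g] and [h]. Every coordinate of the surface and of its normal has
    this shape. *)
Lemma smooth2_prod (a b : Rbar) (g h : R -> R) :
  smooth_on a b g -> smooth_on m_infty p_infty h ->
  smooth2 (fun r _ => itv a b r) (fun u v => g u * h v).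
Proof.
  intros Hg Hh n; revert g h Hg Hh.
  induction n as [|n IH]; intros g h Hg Hh u v Hu;
    assert (Dg := Hg 1%nat u Hu : ex_derive g u);
    assert (Dh := Hh 1%nat v (conj I I) : ex_derive h v);
    (split;
     [ apply continuity_2d_pt_mult;
       [ apply (continuity_1d_2d_pt_comp g (fun x _ => x));
         [ now apply continuity_pt_filterlim, (ex_derive_continuous g)
         | apply continuity_2d_pt_id1 ]
       | apply (continuity_1d_2d_pt_comp h (fun _ y => y));
         [ now apply continuity_pt_filterlim, (ex_derive_continuous h)
         | apply continuity_2d_pt_id2 ] ]
     | ]); [ easy | ].
  split; [ | split; [ | split ] ].
  - apply (ex_derive_mult g (fun _ => h v)); [ exact Dg | apply ex_derive_const ].
  - now apply (ex_derive_scal h).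
  (* The scaling rules for [Derive] need no differentiability, so the two sides are equal on the
     whole plane. *)
  - replace (fun x y => Derive (fun z => g z * h y) x) with (fun x y => Derive g x * h y).
    + apply IH; [ now apply smooth_on_Derive | exact Hh | exact Hu ].
    + extensionality x; extensionality y; now rewrite Derive_scal_l.
  - replace (fun x y => Derive (fun z => g x * h z) y) with (fun x y => g x * Derive h y).
    + apply IH; [ exact Hg | now apply smooth_on_Derive | exact Hu ].
    + extensionality x; extensionality y; now rewrite Derive_scal.
Qed.

Lemma smooth2_radial (a b : Rbar) (g : R -> R) :
  smooth_on a b g -> smooth2 (fun r _ => itv a b r) (fun u _ => g u).
Proof.
  intros Hg; replace (fun u (_ : R) => g u) with (fun u (_ : R) => g u * 1).
  - apply (smooth2_prod a b g (fun _ => 1)); [ exact Hg | apply smooth_on_const ].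
  - extensionality u; extensionality v; ring.
Qed.
(** * The translator equation of a surface of revolution *)

(* With q = f', this is p = 1/(f'^2-1); the normal with negative z-component is
   -(f' cos, f' sin, 1) sqrt p. *)
Definition inv_energy (q : R -> R) (t : R) : R := / (q t ^ 2 - 1).

Definition normal_radial (q : R -> R) (t : R) : R := - (q t * sqrt (inv_energy q t)).

Definition normal_axial (q : R -> R) (t : R) : R := - sqrt (inv_energy q t).

Lemma inv_energy_pos (q : R -> R) (r : R) : 1 < q r ^ 2 -> 0 < inv_energy q r.
Proof. intros H; apply Rinv_0_lt_compat; lra. Qed.

Lemma is_derive_inv_energy (q : R -> R) (r : R) :
  1 < q r ^ 2 -> ex_derive q r ->
  is_derive (inv_energy q) r (- (2 * q r * Derive q r) * inv_energy q r ^ 2).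
Proof.
  intros Hq Dq; unfold inv_energy.
  auto_derive; [ repeat split; auto; simpl in *; lra | ].
  change (fun x => q x) with q; field; lra.
Qed.

Lemma normal_norm (q : R -> R) (r : R) :
  1 < q r ^ 2 -> normal_radial q r ^ 2 - normal_axial q r ^ 2 = 1.
Proof.
  intros Hq; unfold normal_radial, normal_axial.
  transitivity ((q r ^ 2 - 1) * (sqrt (inv_energy q r) ^ 2)); [ ring | ].
  rewrite pow2_sqrt by (apply Rlt_le, inv_energy_pos, Hq).
  unfold inv_energy; field; lra.
Qed.

(** The relation [da = q r * dn] says that N_r is [dn] times X_r, so the meridian direction is
    principal. The last relation is the derivative of [normal_radial]^2 = 1 + [inv_energy], and it
    brings p' into the curvature. The value [dp] is left free so that the right-hand side of the
    translator equation can stand for it. *)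
Lemma is_derive_normal (q : R -> R) (r dp : R) :
  1 < q r ^ 2 -> ex_derive q r -> is_derive (inv_energy q) r dp ->
  exists dn da : R, is_derive (normal_radial q) r dn /\ is_derive (normal_axial q) r da /\
    da = q r * dn /\ 2 * (normal_radial q r * dn) = dp.
Proof.
  intros Hq Dq Dp.
  assert (Hp := inv_energy_pos q r Hq).
  assert (Hs := sqrt_lt_R0 _ Hp).
  assert (Es := pow2_sqrt _ (Rlt_le _ _ Hp)).
  assert (Edp : dp = - (2 * q r * Derive q r) * inv_energy q r ^ 2).
  { rewrite <- (is_derive_unique _ _ _ Dp).
    now apply is_derive_unique, is_derive_inv_energy. }
  assert (Dax : is_derive (normal_axial q) r (q r * Derive q r * sqrt (inv_energy q r) ^ 3)).
  { unfold normal_axial; auto_derive; [ split; [ now exists dp | easy ] | ].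
    change (fun x => inv_energy q x) with (inv_energy q).
    rewrite (is_derive_unique _ _ _ Dp), Edp.
    set (s := sqrt (inv_energy q r)) in *; clearbody s; rewrite <- Es; field; lra. }
  exists (Derive q r * sqrt (inv_energy q r) ^ 3), (q r * Derive q r * sqrt (inv_energy q r) ^ 3).
  assert (E2 : sqrt (inv_energy q r) ^ 2 * (q r ^ 2 - 1) = 1)
    by (rewrite Es; unfold inv_energy; field; lra).
  split; [ | split; [ | split ] ].
  - assert (D := is_derive_mult q (normal_axial q) r _ _ (Derive_correct q r Dq) Dax Rmult_comm).
    apply (is_derive_ext _ (normal_radial q)) in D;
      [ | intros t; unfold normal_radial, normal_axial; simpl; unfold mult; simpl; ring ].
    assert (E : Derive q r * sqrt (inv_energy q r) ^ 3
      = Derive q r * normal_axial q r + q r * (q r * Derive q r * sqrt (inv_energy q r) ^ 3)).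
    { unfold normal_axial; set (s := sqrt (inv_energy q r)) in *; clearbody s.
      transitivity (Derive q r * s * (s ^ 2 * (q r ^ 2 - 1) + s ^ 2 - 1)); [ rewrite E2 | ]; ring. }
    rewrite E; exact D.
  - exact Dax.
  - ring.
  - unfold normal_radial; rewrite Edp.
    set (s := sqrt (inv_energy q r)) in *; clearbody s; rewrite <- Es; ring.
Qed.

Lemma vder1_revolution (f : R -> R) (r th : R) :
  vder1 (revolution f) r th = vec (cos th) (sin th) (Derive f r).
Proof.
  unfold vder1, vderive, revolution; simpl; f_equal;
    apply is_derive_unique; auto_derive; auto; ring.
Qed.

Lemma vder2_revolution (f : R -> R) (r th : R) :
  vder2 (revolution f) r th = vec (- (r * sin th)) (r * cos th) 0.
Proof.
  unfold vder2, vderive, revolution; simpl; f_equal;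
    apply is_derive_unique; auto_derive; auto; ring.
Qed.

Definition rotational_normal (f : R -> R) (r th : R) : V3 :=
  vec (normal_radial (Derive f) r * cos th) (normal_radial (Derive f) r * sin th)
      (normal_axial (Derive f) r).

Lemma lor_rotational_normal (f : R -> R) (r th : R) :
  1 < Derive f r ^ 2 -> lor (rotational_normal f r th) (rotational_normal f r th) = 1.
Proof.
  intros Hq; rewrite <- (normal_norm (Derive f) r Hq).
  assert (E := sin2_cos2 th); unfold Rsqr in E.
  unfold lor, rotational_normal; cbn [vx vy vz].
  transitivity (normal_radial (Derive f) r ^ 2 * (sin th * sin th + cos th * cos th)
    - normal_axial (Derive f) r ^ 2); [ | rewrite E ]; ring.
Qed.

Lemma vder_rotational_normal (f : R -> R) (r th dn da : R) :
  is_derive (normal_radial (Derive f)) r dn -> is_derive (normal_axial (Derive f)) r da ->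
  vder1 (rotational_normal f) r th = vec (dn * cos th) (dn * sin th) da /\
  vder2 (rotational_normal f) r th =
    vec (- (normal_radial (Derive f) r * sin th)) (normal_radial (Derive f) r * cos th) 0.
Proof.
  intros Dn Da; unfold vder1, vder2, vderive, rotational_normal; cbn [vx vy vz].
  split; f_equal; rewrite ?Derive_scal_l, ?Derive_scal, ?Derive_const;
    rewrite ?(is_derive_unique _ _ _ Dn), ?(is_derive_unique _ _ _ Da); try reflexivity.
  - exact (is_derive_unique _ _ _ Da).
  - rewrite (is_derive_unique _ _ _ (is_derive_cos th)); ring.
  - now rewrite (is_derive_unique _ _ _ (is_derive_sin th)).
Qed.

Lemma tangent_revolution (f : R -> R) (r th c d : R) :
  tangent (revolution f) r th c d =
  vec (c * cos th - d * r * sin th) (c * sin th + d * r * cos th) (c * Derive f r).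
Proof.
  unfold tangent, vadd, vscal; rewrite vder1_revolution, vder2_revolution; simpl.
  f_equal; ring.
Qed.

Lemma lor_tangent_revolution (f : R -> R) (r th c d c' d' : R) :
  lor (tangent (revolution f) r th c d) (tangent (revolution f) r th c' d') =
  c * c' * (1 - Derive f r ^ 2) + d * d' * r ^ 2.
Proof.
  rewrite !tangent_revolution; unfold lor; simpl.
  assert (E := sin2_cos2 th); unfold Rsqr in E.
  transitivity (c * c' * ((sin th * sin th + cos th * cos th) - Derive f r ^ 2)
    + d * d' * r ^ 2 * (sin th * sin th + cos th * cos th)); [ ring | rewrite E; ring ].
Qed.

(** The first fundamental form is diagonal with entries 1 - f'^2 and r^2, so a vector of square -1
    forces f'^2 > 1. Conversely, X_theta and X_r, divided by r and by sqrt(f'^2 - 1), are an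
    orthonormal pair. *)
Lemma lorentzian_revolution (f : R -> R) (r th : R) :
  0 < r -> (lorentzian_at (revolution f) r th <-> 1 < Derive f r ^ 2).
Proof.
  intros Hr; unfold lorentzian_at; split.
  - intros [a [b [c [d H]]]]; cbv zeta in H; rewrite !lor_tangent_revolution in H.
    destruct H as [_ [H _]]; apply Rnot_le_lt; intros Hle; nra.
  - intros H; exists 0, (/ r), (/ sqrt (Derive f r ^ 2 - 1)), 0; cbv zeta.
    rewrite !lor_tangent_revolution.
    assert (H' : 0 < Derive f r ^ 2 - 1) by lra.
    assert (Hs := sqrt_lt_R0 _ H').
    assert (Es := pow2_sqrt _ (Rlt_le _ _ H')).
    repeat split; [ field; lra | | ring ].
    replace (1 - Derive f r ^ 2) with (- sqrt (Derive f r ^ 2 - 1) ^ 2) by lra.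
    field; lra.
Qed.

(** Orthogonality to X_theta kills the angular component, and orthogonality to X_r makes the radial
    one f' z. The norm then gives z^2 = [inv_energy], and the sign of z selects the root. The
    argument is pointwise, so no continuity of the normal is involved. *)
Lemma rotational_normal_unique (f : R -> R) (r th : R) (n : V3) :
  0 < r -> 1 < Derive f r ^ 2 -> vz n < 0 ->
  lor n n = 1 -> lor n (vder1 (revolution f) r th) = 0 ->
  lor n (vder2 (revolution f) r th) = 0 ->
  n = rotational_normal f r th.
Proof.
  rewrite vder1_revolution, vder2_revolution.
  destruct n as [x y z]; unfold lor, rotational_normal; cbn [vx vy vz].
  intros Hr Hq Hz H0 H1 H2.
  assert (E := sin2_cos2 th); unfold Rsqr in E.
  assert (H3 : - x * sin th + y * cos th = 0).
  { apply Rmult_eq_reg_l with r; lra. }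
  assert (Ex : x = Derive f r * z * cos th).
  { transitivity (x * (sin th * sin th + cos th * cos th)); [ rewrite E; ring | ].
    transitivity ((x * cos th + y * sin th) * cos th - (- x * sin th + y * cos th) * sin th); [ ring | ].
    rewrite H3; replace (x * cos th + y * sin th) with (z * Derive f r) by lra; ring. }
  assert (Ey : y = Derive f r * z * sin th).
  { transitivity (y * (sin th * sin th + cos th * cos th)); [ rewrite E; ring | ].
    transitivity ((x * cos th + y * sin th) * sin th + (- x * sin th + y * cos th) * cos th); [ ring | ].
    rewrite H3; replace (x * cos th + y * sin th) with (z * Derive f r) by lra; ring. }
  assert (Ez : z = normal_axial (Derive f) r).
  { assert (Ep : inv_energy (Derive f) r = Rsqr (- z)).
    { unfold Rsqr, inv_energy.
      apply Rmult_eq_reg_r with (Derive f r ^ 2 - 1); [ | lra ].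
      rewrite Rinv_l by lra; rewrite <- H0 at 1; rewrite Ex, Ey.
      transitivity (Derive f r ^ 2 * z ^ 2 * (sin th * sin th + cos th * cos th) - z * z);
        [ | rewrite E ]; ring. }
    unfold normal_axial; rewrite Ep, sqrt_Rsqr by lra; ring. }
  unfold normal_radial; fold (normal_axial (Derive f) r).
  rewrite Ex, Ey, Ez; unfold normal_axial; f_equal; ring.
Qed.

Lemma translator_ode (alpha : R) (a b : Rbar) (f : R -> R) (r : R) :
  alpha <> 0 -> pos_interval a b -> rotational_translator alpha a b f -> itv a b r ->
  1 < Derive f r ^ 2 /\
  is_derive (inv_energy (Derive f)) r
    (2 * r * Rpower (inv_energy (Derive f) r) (/ (2 * alpha))).
Proof.
  intros Ha Hab [Hf [[_ Hl] [N [[_ HN] HK]]]] Hr.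
  assert (Hq : forall t, itv a b t -> 1 < Derive f t ^ 2).
  { intros t Ht; apply (lorentzian_revolution f t 0); [ now apply (pos_interval_pos a b) | ].
    now apply Hl. }
  assert (Hr0 := pos_interval_pos a b r Hab Hr).
  split; [ now apply Hq | ].
  assert (EN : forall t th, itv a b t -> N t th = rotational_normal f t th).
  { intros t th Ht.
    destruct (HN t th Ht) as [H0 [H1 H2]], (HK t th Ht) as [K [_ [_ EK]]].
    apply rotational_normal_unique; auto; [ now apply (pos_interval_pos a b) | ].
    assert (HR : 0 < Rpower K alpha) by apply exp_pos.
    rewrite EK in HR; unfold lor in HR; simpl in HR; lra. }
  assert (Dq : ex_derive (Derive f) r) by exact (smooth_on_Derive a b f Hf 1%nat r Hr).
  assert (Dp := is_derive_inv_energy (Derive f) r (Hq r Hr) Dq).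
  destruct (is_derive_normal (Derive f) r _ (Hq r Hr) Dq Dp) as [dn [da [Dn [Da [_ Edp]]]]].
  rewrite <- Edp in Dp.
  (* The equation involves only r, so the angle 0 is enough; there the Weingarten equations become
     linear in the matrix entries. *)
  destruct (vder_rotational_normal f r 0 dn da Dn Da) as [E1 E2].
  destruct (HK r 0 Hr) as [K [[x [y [c [d [[W1 W2] EK]]]]] [HKpos Hpow]]].
  assert (E1' : vder1 N r 0 = vder1 (rotational_normal f) r 0).
  { unfold vder1, vderive; f_equal; apply Derive_ext_loc;
      (eapply filter_imp; [ | apply (itv_locally a b r Hr) ]; intros t Ht; now rewrite EN). }
  assert (E2' : vder2 N r 0 = vder2 (rotational_normal f) r 0).
  { unfold vder2, vderive; f_equal; apply Derive_ext; intros t; now rewrite EN. }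
  rewrite E1', E1, tangent_revolution in W1; rewrite E2', E2, tangent_revolution in W2.
  unfold vopp, vscal in W1, W2; cbn [vx vy vz] in W1, W2; rewrite sin_0, cos_0 in W1, W2.
  injection W1 as W1x W1y W1z; injection W2 as W2x W2y W2z.
  destruct (HN r 0 Hr) as [HN1 _]; rewrite HN1 in EK.
  assert (Hx : x = - dn) by lra.
  assert (Hc : c = 0) by lra.
  assert (Hd : d * r = - normal_radial (Derive f) r) by lra.
  assert (EKr : K * r = normal_radial (Derive f) r * dn).
  { rewrite EK, Hx, Hc; replace ((1 * (- dn * d - y * 0)) * r) with (- dn * (d * r)) by ring.
    rewrite Hd; ring. }
  assert (Hsq : Rpower K alpha = sqrt (inv_energy (Derive f) r)).
  { rewrite Hpow, EN by exact Hr; unfold lor, rotational_normal, normal_axial; simpl; ring. }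
  (* Raising K^alpha = p^(1/2) to the power 1/alpha solves for K. *)
  assert (EKp : K = Rpower (inv_energy (Derive f) r) (/ (2 * alpha))).
  { rewrite <- (Rpower_1 K HKpos).
    replace 1 with (alpha * / alpha) by now field.
    rewrite <- Rpower_mult, Hsq, <- Rpower_sqrt by now apply inv_energy_pos, Hq.
    rewrite Rpower_mult; f_equal; now field. }
  rewrite <- EKp; replace (2 * r * K) with (2 * (K * r)) by ring; now rewrite EKr.
Qed.

Lemma ode_translator (alpha : R) (a b : Rbar) (f : R -> R) :
  alpha <> 0 -> pos_interval a b -> smooth_on a b f ->
  (forall r, itv a b r ->
     1 < Derive f r ^ 2 /\
     is_derive (inv_energy (Derive f)) r
       (2 * r * Rpower (inv_energy (Derive f) r) (/ (2 * alpha)))) ->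
  rotational_translator alpha a b f.
Proof.
  intros Ha Hab Hf Hode.
  assert (Hpos : forall r, itv a b r -> 0 < r) by (intros r; now apply pos_interval_pos).
  assert (Hinv : forall r, itv a b r -> 0 < inv_energy (Derive f) r).
  { intros r Hr; now apply inv_energy_pos, Hode. }
  assert (Hsm : elementary a b (inv_energy (Derive f))).
  { apply el_smooth.
    (* [elementary] has no constructor for inverses or square roots; here and below they are written
       as real powers with exponents -1 and 1/2. *)
    apply smooth_on_ext with (fun t => Rpower (Derive f t * Derive f t + (-1)) (- (1))).
    - intros r Hr; destruct (Hode r Hr) as [H _].
      rewrite Rpower_Ropp, Rpower_1 by lra; unfold inv_energy; f_equal; ring.
    - apply smooth_on_elementary, el_Rpower.
      + intros r Hr; destruct (Hode r Hr) as [H _]; lra.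
      + apply el_plus; [ apply el_mult | ]; apply el_smooth;
          [ apply smooth_on_Derive, Hf .. | apply smooth_on_const ]. }
  assert (Hax : elementary a b (normal_axial (Derive f))).
  { apply el_smooth.
    apply smooth_on_ext with (fun t => (-1) * Rpower (inv_energy (Derive f) t) (/ 2)).
    - intros r Hr; rewrite Rpower_sqrt by auto; unfold normal_axial; ring.
    - apply smooth_on_elementary, el_mult; [ apply el_smooth, smooth_on_const | now apply el_Rpower ]. }
  assert (Hrad : elementary a b (normal_radial (Derive f))).
  { apply el_smooth.
    apply smooth_on_ext with (fun t => Derive f t * normal_axial (Derive f) t).
    - intros r Hr; unfold normal_radial, normal_axial; ring.
    - apply smooth_on_elementary, el_mult; [ apply el_smooth, smooth_on_Derive, Hf | exact Hax ]. }
  apply smooth_on_elementary in Hax, Hrad.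
  split; [ exact Hf | ]; split; [ split | ].
  - split; [ | split ].
    + apply (smooth2_prod a b (fun r => r) cos); [ apply smooth_on_id | apply smooth_cos ].
    + apply (smooth2_prod a b (fun r => r) sin); [ apply smooth_on_id | apply smooth_sin ].
    + now apply (smooth2_radial a b f).
  - intros r th Hr; apply lorentzian_revolution; [ now apply Hpos | now apply Hode ].
  - exists (rotational_normal f); split; [ split | ].
    + split; [ | split ].
      * apply (smooth2_prod a b _ cos); [ exact Hrad | apply smooth_cos ].
      * apply (smooth2_prod a b _ sin); [ exact Hrad | apply smooth_sin ].
      * exact (smooth2_radial a b _ Hax).
    + intros r th Hr; rewrite vder1_revolution, vder2_revolution.
      assert (E := sin2_cos2 th); unfold Rsqr in E.
      split; [ now apply lor_rotational_normal, Hode | ].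
      unfold lor, rotational_normal; cbn [vx vy vz]; split.
      * transitivity (normal_radial (Derive f) r * (sin th * sin th + cos th * cos th)
          - normal_axial (Derive f) r * Derive f r); [ ring | rewrite E ].
        unfold normal_radial, normal_axial; ring.
      * ring.
    + intros r th Hr; destruct (Hode r Hr) as [Hq Dp].
      assert (Dq : ex_derive (Derive f) r) by exact (smooth_on_Derive a b f Hf 1%nat r Hr).
      destruct (is_derive_normal (Derive f) r _ Hq Dq Dp) as [dn [da [Dn [Da [Eda Edp]]]]].
      destruct (vder_rotational_normal f r th dn da Dn Da) as [E1 E2].
      assert (Hr0 := Hpos r Hr).
      exists (Rpower (inv_energy (Derive f) r) (/ (2 * alpha))); split; [ | split ].
      (* The diagonal entries are the principal curvatures along the meridian and the parallel. *)
      * exists (- dn), 0, 0, (- (normal_radial (Derive f) r / r)); split.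
        { unfold weingarten; rewrite E1, E2, !tangent_revolution.
          unfold vopp, vscal; cbn [vx vy vz]; rewrite Eda.
          split; f_equal; field; lra. }
        rewrite lor_rotational_normal by exact Hq.
        apply Rmult_eq_reg_l with (2 * r); [ rewrite <- Edp; field; lra | lra ].
      * apply exp_pos.
      * rewrite Rpower_mult; replace (/ (2 * alpha) * alpha) with (/ 2) by now field.
        rewrite Rpower_sqrt by auto.
        unfold lor, rotational_normal, normal_axial; simpl; ring.
Qed.

(** * Integration of the equation *)

Definition base (alpha m t : R) : R := m + (2 * alpha - 1) / (2 * alpha) * t ^ 2.

Lemma is_derive_base (alpha m r : R) :
  is_derive (base alpha m) r ((2 * alpha - 1) / (2 * alpha) * (2 * r)).
Proof. unfold base; auto_derive; [ easy | ring ]. Qed.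

Lemma Rpower_pos (x y : R) : 0 < Rpower x y.
Proof. apply exp_pos. Qed.

Lemma first_integral_half (a b : Rbar) (f : R -> R) :
  pos_interval a b -> rotational_translator (1 / 2) a b f ->
  exists m, 0 < m /\
    forall r, itv a b r -> Derive f r ^ 2 - 1 = 1 / m ^ 2 * exp (- r ^ 2).
Proof.
  intros Hab Hf.
  assert (Hode := fun r => translator_ode (1 / 2) a b f r ltac:(lra) Hab Hf).
  (* For alpha = 1/2 the equation is the linear p' = 2 r p, with integrating factor exp(-r^2). *)
  set (G := fun t => inv_energy (Derive f) t * exp (- t ^ 2)).
  assert (HG : forall r, itv a b r -> is_derive G r 0).
  { intros r Hr; destruct (Hode r Hr) as [Hq Dp].
    assert (Hp := inv_energy_pos _ r Hq).
    replace (/ (2 * (1 / 2))) with 1 in Dp by field.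
    rewrite (Rpower_1 _ Hp) in Dp.
    unfold G; auto_derive; [ exact (ex_intro _ _ Dp) | ].
    change (fun x => inv_energy (Derive f) x) with (inv_energy (Derive f)).
    rewrite (is_derive_unique _ _ _ Dp); ring. }
  destruct (itv_inhabited a b (proj2 Hab)) as [r0 Hr0].
  assert (HGpos : 0 < G r0).
  { apply Rmult_lt_0_compat; [ now apply inv_energy_pos, Hode | apply exp_pos ]. }
  exists (sqrt (G r0)); split; [ now apply sqrt_lt_R0 | ].
  intros r Hr; rewrite pow2_sqrt by lra.
  rewrite (eq_on_itv a b G HG r0 r Hr0 Hr).
  destruct (Hode r Hr) as [Hq _].
  assert (He := exp_pos (- r ^ 2)).
  unfold G, inv_energy; field; split; lra.
Qed.

(** With k = 1 - 1/(2 alpha), the factor p^(k-1) cancels p^(1/(2 alpha)) and (p^k)' = 2 k r; the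
    constant is the value of p^k - k r^2. Positivity of the base comes for free, since the base
    equals the power p^k. *)
Lemma first_integral (alpha : R) (a b : Rbar) (f : R -> R) :
  alpha <> 0 -> alpha <> 1 / 2 ->
  pos_interval a b -> rotational_translator alpha a b f ->
  exists m, forall r, itv a b r ->
    0 < base alpha m r /\
    Derive f r ^ 2 - 1 = Rpower (base alpha m r) (2 * alpha / (1 - 2 * alpha)).
Proof.
  intros Ha Ha2 Hab Hf.
  assert (Hode := fun r => translator_ode alpha a b f r Ha Hab Hf).
  set (k := (2 * alpha - 1) / (2 * alpha)).
  set (p := inv_energy (Derive f)) in *.
  set (G := fun t => Rpower (p t) k - k * t ^ 2).
  assert (HG : forall r, itv a b r -> is_derive G r 0).
  { intros r Hr; destruct (Hode r Hr) as [Hq Dp].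
    assert (Hp : 0 < p r) by exact (inv_energy_pos _ r Hq).
    assert (Dpow := is_derive_Rpower p k r _ Hp Dp).
    assert (Dsq : is_derive (fun t => k * t ^ 2) r (k * (2 * r))) by (auto_derive; [ easy | ring ]).
    assert (D := is_derive_minus _ _ r _ _ Dpow Dsq).
    assert (E1 : Rpower (p r) (k - 1) * Rpower (p r) (/ (2 * alpha)) = 1).
    { rewrite <- Rpower_plus; replace (k - 1 + / (2 * alpha)) with 0 by (unfold k; field; lra).
      now apply Rpower_O. }
    assert (E : 0 = k * Rpower (p r) (k - 1) * (2 * r * Rpower (p r) (/ (2 * alpha))) - k * (2 * r)).
    { transitivity (k * (2 * r) * (Rpower (p r) (k - 1) * Rpower (p r) (/ (2 * alpha))) - k * (2 * r));
        [ rewrite E1 | ]; ring. }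
    rewrite E; exact D. }
  destruct (itv_inhabited a b (proj2 Hab)) as [r0 Hr0].
  exists (G r0); intros r Hr.
  destruct (Hode r Hr) as [Hq _].
  assert (Hp : 0 < p r) by exact (inv_energy_pos _ r Hq).
  assert (EB : base alpha (G r0) r = Rpower (p r) k).
  { rewrite (eq_on_itv a b G HG r0 r Hr0 Hr); unfold base, G, k; ring. }
  rewrite EB; split; [ apply Rpower_pos | ].
  rewrite Rpower_mult.
  replace (k * (2 * alpha / (1 - 2 * alpha))) with (- (1)) by (unfold k; field; lra).
  rewrite Rpower_Ropp, Rpower_1 by exact Hp.
  unfold p, inv_energy; now rewrite Rinv_inv.
Qed.

(** * Values of the profile formula and the sign of its base *)

Lemma is_power_of_pos (b p y : R) : 0 < b -> (is_power b p y <-> y = Rpower b p).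
Proof.
  intros Hb; split.
  - intros [ | Hb0 _ | k Hk _]; [ easy | lra | ].
    rewrite Hk; now apply powerRZ_Rpower.
  - intros ->; now apply power_pos.
Qed.

Lemma Rabs_powerRZ (x : R) (k : Z) : Rabs (powerRZ x k) = powerRZ (Rabs x) k.
Proof.
  destruct k; simpl; [ apply Rabs_R1 | symmetry; apply RPow_abs | ].
  now rewrite Rabs_inv, RPow_abs.
Qed.

(** A positive value over a negative base can come only from [power_int], and absolute values
    commute with integer powers. *)
Lemma is_power_gt_0 (b p y : R) :
  is_power b p y -> 0 < y -> b <> 0 /\ y = Rpower (Rabs b) p.
Proof.
  intros [Hb | Hb _ | k Hk Hb] Hy.
  - split; [ lra | now rewrite Rabs_pos_eq by lra ].
  - lra.
  - split; [ exact Hb | ].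
    rewrite <- (Rabs_pos_eq (powerRZ b k)), Rabs_powerRZ, Hk by lra.
    now apply powerRZ_Rpower, Rabs_pos_lt.
Qed.

Lemma Rpower_inj_l (x y p : R) :
  0 < x -> 0 < y -> p <> 0 -> Rpower x p = Rpower y p -> x = y.
Proof.
  intros Hx Hy Hp H.
  rewrite <- (Rpower_1 x Hx), <- (Rpower_1 y Hy).
  replace 1 with (p * / p) by now field.
  now rewrite <- !Rpower_mult, H.
Qed.

Lemma profile_Derive (alpha s m : R) (a b : Rbar) (f : R -> R) (r : R) :
  is_sign s -> is_profile alpha s m a b f -> itv a b r ->
  profile_term alpha m r (Derive f r ^ 2 - 1).
Proof.
  intros Hs Hf Hr; destruct (Hf r Hr) as [y [Hy [Hy0 Dy]]].
  rewrite (is_derive_unique _ _ _ Dy).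
  replace ((s * sqrt (1 + y)) ^ 2 - 1) with y; [ exact Hy | ].
  rewrite Rpow_mult_distr, pow2_sqrt by exact Hy0; destruct Hs as [-> | ->]; ring.
Qed.

(* An even integer exponent can make the formula produce a timelike surface
   where the base is negative.  The energy would then be |base m|^p for this m
   and (base m')^p for the m' of the first integral, so base m' = - base m
   wherever base m is negative, which is possible at no more than one radius. *)
Lemma profile_domain_base_pos (alpha s m : R) (a b : Rbar) (r : R) :
  alpha <> 0 -> alpha <> 1 / 2 -> is_sign s ->
  profile_domain alpha s m a b -> itv a b r -> 0 < base alpha m r.
Proof.
  intros Ha Ha2 Hs [Hab [[f Hf] Htr]] Hr.
  (* The constant [m'] belongs to [f] as a translator and may a priori differ from the [m] of the
     formula. *)
  destruct (first_integral alpha a b f Ha Ha2 Hab (Htr f Hf)) as [m' Hm'].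
  set (k := (2 * alpha - 1) / (2 * alpha)).
  assert (Hk : k <> 0).
  { unfold k, Rdiv; apply Rmult_integral_contrapositive; split; [ lra | apply Rinv_neq_0_compat; lra ]. }
  assert (Hp0 : 2 * alpha / (1 - 2 * alpha) <> 0).
  { unfold Rdiv; apply Rmult_integral_contrapositive; split; [ lra | apply Rinv_neq_0_compat; lra ]. }
  assert (Habs : forall t, itv a b t -> base alpha m t <> 0 /\ Rabs (base alpha m t) = base alpha m' t).
  { intros t Ht; destruct (Hm' t Ht) as [Hpos E].
    destruct (profile_Derive alpha s m a b f t Hs Hf Ht) as [[H _]|[_ Hpow]]; [ easy | ].
    rewrite E in Hpow.
    apply is_power_gt_0 in Hpow; [ | apply Rpower_pos ].
    destruct Hpow as [Hb Hpow]; split; [ exact Hb | ].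
    symmetry; apply Rpower_inj_l in Hpow; auto; now apply Rabs_pos_lt. }
  destruct (Rtotal_order 0 (base alpha m r)) as [H | [H | Hneg]];
    [ exact H | now destruct (proj1 (Habs r Hr)) | exfalso ].
  assert (Hr0 := pos_interval_pos a b r Hab Hr).
  (* At [t] the base is no larger than at [r], hence negative too. Then 2 k t^2 and 2 k r^2 both
     equal -(m + m'), so t = r. The case distinction on k below finds such a [t] to the right or to
     the left of [r]. *)
  assert (Hcase : forall t, itv a b t -> 0 < t -> t <> r -> 0 <= k * (r ^ 2 - t ^ 2) -> False).
  { intros t Ht Ht0 Htr' Hkt.
    assert (Hneg' : base alpha m t < 0) by (unfold base in *; fold k in Hneg |- *; lra).
    destruct (Habs r Hr) as [_ E1], (Habs t Ht) as [_ E2].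
    rewrite Rabs_left in E1, E2 by assumption.
    unfold base in E1, E2; fold k in E1, E2.
    assert (E : k * ((r - t) * (r + t)) = 0) by lra.
    apply Rmult_integral in E; destruct E as [E | E]; [ easy | ].
    apply Rmult_integral in E; lra. }
  destruct Hr as [Har Hrb]; destruct (Rtotal_order k 0) as [Hk0 | [Hk0 | Hk0]]; [ | easy | ].
  - destruct (itv_inhabited r b Hrb) as [t [Hrt Htb]]; simpl in Hrt.
    apply (Hcase t); [ split; [ apply Rbar_lt_trans with r; assumption | exact Htb ] | lra | lra | ].
    replace (k * (r ^ 2 - t ^ 2)) with (- k * ((t - r) * (t + r))) by ring.
    apply Rmult_le_pos; [ | apply Rmult_le_pos ]; lra.
  - destruct (itv_inhabited a r Har) as [t [Hat Htr']]; simpl in Htr'.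
    assert (Hin : itv a b t) by (split; [ exact Hat | apply Rbar_lt_trans with r; assumption ]).
    assert (Ht0 := pos_interval_pos a b t Hab Hin).
    apply (Hcase t); [ exact Hin | lra | lra | ].
    replace (k * (r ^ 2 - t ^ 2)) with (k * ((r - t) * (r + t))) by ring.
    apply Rmult_le_pos; [ | apply Rmult_le_pos ]; lra.
Qed.

(** * Profiles given by the formula are translators *)

Lemma ex_primitive_itv (a b : Rbar) (g : R -> R) :
  Rbar_lt a b -> (forall r, itv a b r -> continuous g r) ->
  exists f, forall r, itv a b r -> is_derive f r (g r).
Proof.
  intros Hab Hg; destruct (itv_inhabited a b Hab) as [r0 Hr0].
  exists (fun r => RInt g r0 r); intros r Hr.
  apply is_derive_RInt with r0; [ | now apply Hg ].
  eapply filter_imp; [ | apply (itv_locally a b r Hr) ].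
  intros t Ht; apply (RInt_correct g), (ex_RInt_continuous g).
  intros z Hz; apply Hg; revert Hz; unfold Rmin, Rmax; destruct Rle_dec; intros Hz.
  - now apply (itv_between a b r0 t).
  - now apply (itv_between a b t r0).
Qed.

(** Here [w] plays the role of f'^2 - 1, so 1/w is the [inv_energy] of a profile. The last
    hypothesis makes the formula single-valued, so that one [w] serves every antiderivative at
    once. *)
Lemma profile_domain_intro (alpha s m : R) (a b : Rbar) (w : R -> R) :
  alpha <> 0 -> is_sign s -> pos_interval a b -> smooth_on a b w ->
  (forall r, itv a b r ->
     0 < w r /\ is_derive (fun t => / w t) r (2 * r * Rpower (/ w r) (/ (2 * alpha)))) ->
  (forall r y, itv a b r -> (profile_term alpha m r y <-> y = w r)) ->
  profile_domain alpha s m a b.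
Proof.
  intros Ha Hs Hab Hw Hode Hterm.
  set (g := fun t => s * sqrt (1 + w t)).
  assert (Hg : smooth_on a b g).
  { apply smooth_on_ext with (fun t => s * Rpower (1 + w t) (/ 2)).
    - intros r Hr; unfold g; rewrite Rpower_sqrt; [ easy | destruct (Hode r Hr); lra ].
    - apply smooth_on_elementary, el_mult; [ apply el_smooth, smooth_on_const | apply el_Rpower ].
      + intros r Hr; destruct (Hode r Hr); lra.
      + apply el_plus; apply el_smooth; [ apply smooth_on_const | exact Hw ]. }
  split; [ exact Hab | split ].
  - destruct (ex_primitive_itv a b g (proj2 Hab)) as [f Hf].
    { intros r Hr; apply (ex_derive_continuous g), (Hg 1%nat r Hr). }
    exists f; intros r Hr; exists (w r); split; [ now apply Hterm | ].
    split; [ destruct (Hode r Hr); lra | now apply Hf ].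
  - intros f Hf.
    assert (Df : forall r, itv a b r -> is_derive f r (g r)).
    { intros r Hr; destruct (Hf r Hr) as [y [Hy [_ Dy]]].
      apply Hterm in Hy; [ now rewrite Hy in Dy | exact Hr ]. }
    assert (Ew : forall r, itv a b r -> Derive f r ^ 2 = 1 + w r).
    { intros r Hr; rewrite (is_derive_unique _ _ _ (Df r Hr)); unfold g.
      rewrite Rpow_mult_distr, pow2_sqrt by (destruct (Hode r Hr); lra).
      destruct Hs as [-> | ->]; ring. }
    assert (Ep : forall r, itv a b r -> / w r = inv_energy (Derive f) r).
    { intros r Hr; unfold inv_energy; rewrite Ew by exact Hr; f_equal; ring. }
    apply ode_translator; auto.
    + now apply smooth_on_primitive with g.
    + intros r Hr; destruct (Hode r Hr) as [Hw0 Dw]; split; [ rewrite Ew by exact Hr; lra | ].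
      rewrite <- (Ep r Hr); apply is_derive_ext_loc with (fun t => / w t); [ | exact Dw ].
      eapply filter_imp; [ | apply (itv_locally a b r Hr) ]; exact Ep.
Qed.

Lemma profile_domain_half (s m : R) (a b : Rbar) :
  is_sign s -> 0 < m -> pos_interval a b -> profile_domain (1 / 2) s m a b.
Proof.
  intros Hs Hm Hab.
  assert (Hm2 : 0 < m ^ 2) by nra.
  apply profile_domain_intro with (fun t => 1 / m ^ 2 * exp (- t ^ 2)); auto; [ lra | | | ].
  - apply smooth_on_elementary, el_mult; [ apply el_smooth, smooth_on_const | apply el_exp, el_smooth ].
    apply smooth_on_ext with (fun t => (-1) * (t * t)); [ intros; ring | ].
    apply smooth_on_elementary, el_mult; [ | apply el_mult ]; apply el_smooth;
      [ apply smooth_on_const | apply smooth_on_id .. ].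
  - intros r Hr.
    assert (He := exp_pos (- r ^ 2)).
    assert (Hw : 0 < 1 / m ^ 2 * exp (- r ^ 2)).
    { apply Rmult_lt_0_compat; [ apply Rdiv_lt_0_compat; lra | exact He ]. }
    split; [ exact Hw | ].
    replace (/ (2 * (1 / 2))) with 1 by field.
    rewrite Rpower_1 by now apply Rinv_0_lt_compat.
    auto_derive; [ apply Rgt_not_eq, Hw | ].
    simpl; simpl in He; field; split; lra.
  - intros r y _; split; [ intros [[_ Hy]|[Hn _]]; [ exact Hy | easy ] | now left ].
Qed.

Lemma profile_domain_of_base_pos (alpha s m : R) (a b : Rbar) :
  alpha <> 0 -> alpha <> 1 / 2 -> is_sign s -> pos_interval a b ->
  (forall r, itv a b r -> 0 < base alpha m r) -> profile_domain alpha s m a b.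
Proof.
  intros Ha Ha2 Hs Hab Hpos.
  set (p := 2 * alpha / (1 - 2 * alpha)).
  apply profile_domain_intro with (fun t => Rpower (base alpha m t) p); auto.
  - apply smooth_on_elementary, el_Rpower; [ exact Hpos | unfold base; apply el_plus ].
    + apply el_smooth, smooth_on_const.
    + apply el_mult; [ apply el_smooth, smooth_on_const | ].
      apply el_smooth, smooth_on_ext with (fun t => t * t); [ intros; ring | ].
      apply smooth_on_elementary, el_mult; apply el_smooth, smooth_on_id.
  - intros r Hr; split; [ apply Rpower_pos | ].
    apply is_derive_ext with (fun t => Rpower (base alpha m t) (- p)).
    { intros t; apply Rpower_Ropp. }
    rewrite <- Rpower_Ropp, Rpower_mult.
    assert (D := is_derive_Rpower _ (- p) r _ (Hpos r Hr) (is_derive_base alpha m r)).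
    assert (E : 2 * r * Rpower (base alpha m r) (- p * / (2 * alpha))
      = - p * Rpower (base alpha m r) (- p - 1) * ((2 * alpha - 1) / (2 * alpha) * (2 * r))).
    (* Both p + 1 and p/(2 alpha) equal 1/(1 - 2 alpha), and -p is the reciprocal of the coefficient
       of t^2 in [base]. *)
    { replace (- p * / (2 * alpha)) with (- p - 1) by (unfold p; field; lra).
      unfold p; field; lra. }
    rewrite E; exact D.
  - intros r y Hr; unfold profile_term; fold (base alpha m r); fold p; split.
    + intros [[Hn _]|[_ Hy]]; [ easy | now apply is_power_of_pos in Hy; [ | apply Hpos ] ].
    + intros Hy; right; split; [ exact Ha2 | ]; apply is_power_of_pos; auto.
Qed.

(** * Maximal domains *)

(** Every domain of the formula lies in the positivity set of the base by [profile_domain_base_pos].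
    For alpha other than 1/2, only a quadratic inequality in r remains to be solved. *)
Lemma maximal_domain_of_base_pos (alpha s m : R) (a b : Rbar) :
  alpha <> 0 -> alpha <> 1 / 2 -> is_sign s -> pos_interval a b ->
  (forall r, 0 < r -> (itv a b r <-> 0 < base alpha m r)) ->
  maximal_domain alpha s m a b.
Proof.
  intros Ha Ha2 Hs Hab Hiff; split.
  - apply profile_domain_of_base_pos; auto.
    intros r Hr; apply Hiff; [ now apply (pos_interval_pos a b) | exact Hr ].
  - intros c d Hcd; apply itv_subset; [ apply Hcd | ].
    intros r Hr; apply Hiff; [ now apply (pos_interval_pos c d); [ apply Hcd | ] | ].
    now apply (profile_domain_base_pos alpha s m c d).
Qed.

Lemma lt_sqrt_iff (r x : R) : 0 < r -> 0 <= x -> (r < sqrt x <-> r ^ 2 < x).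
Proof.
  intros Hr Hx; assert (Hs := sqrt_pos x); assert (E := pow2_sqrt x Hx); split; intros H; nra.
Qed.

Lemma sqrt_lt_iff (r x : R) : 0 < r -> 0 <= x -> (sqrt x < r <-> x < r ^ 2).
Proof.
  intros Hr Hx; assert (Hs := sqrt_pos x); assert (E := pow2_sqrt x Hx); split; intros H; nra.
Qed.

(** Exhibits the square of the critical radius; the sign of the leading factor decides on which side
    of it the domain lies. *)
Lemma base_factor (alpha m r : R) :
  alpha <> 0 -> alpha <> 1 / 2 ->
  base alpha m r =
  (2 * alpha - 1) / (2 * alpha) * (r ^ 2 - 2 * alpha / (1 - 2 * alpha) * m).
Proof. intros Ha Ha2; unfold base; field; lra. Qed.

(** Since f'^2 > 1, the continuous f' never vanishes, so a single sign serves the whole interval. *)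
Lemma translator_profile_sign (alpha : R) (a b : Rbar) (f : R -> R) :
  alpha <> 0 -> pos_interval a b -> rotational_translator alpha a b f ->
  exists s, is_sign s /\ forall r, itv a b r ->
    1 < Derive f r ^ 2 /\ is_derive f r (s * sqrt (Derive f r ^ 2)).
Proof.
  intros Ha Hab Hf.
  assert (Hq : forall r, itv a b r -> 1 < Derive f r ^ 2).
  { intros r Hr; now apply (translator_ode alpha a b f r). }
  destruct (sign_on_itv a b (Derive f)) as [s [Hs Hpos]].
  - intros r Hr; apply (ex_derive_continuous (Derive f)).
    exact (smooth_on_Derive a b f (proj1 Hf) 1%nat r Hr).
  - intros r Hr H0; assert (H := Hq r Hr); rewrite H0 in H; simpl in H; lra.
  - exists s; split; [ exact Hs | ]; intros r Hr; split; [ now apply Hq | ].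
    assert (Hr' := Hpos r Hr).
    replace (Derive f r ^ 2) with (Rsqr (s * Derive f r))
      by (destruct Hs as [-> | ->]; unfold Rsqr; ring).
    rewrite sqrt_Rsqr by lra.
    assert (E : Derive f r = s * (s * Derive f r)) by (destruct Hs as [-> | ->]; ring).
    rewrite <- E; now apply (smooth_on_is_derive a b); [ apply Hf | ].
Qed.

Lemma base_nonpos (alpha m r : R) :
  0 < alpha < 1 / 2 -> m <= 0 -> base alpha m r <= 0.
Proof.
  intros Hal Hm; unfold base.
  replace ((2 * alpha - 1) / (2 * alpha)) with (- ((1 - 2 * alpha) / (2 * alpha))) by (field; lra).
  assert (Hk : 0 < (1 - 2 * alpha) / (2 * alpha)) by (apply Rdiv_lt_0_compat; lra).
  assert (Hr := pow2_ge_0 r); nra.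
Qed.

Theorem theorem4p2 : forall alpha : R, alpha <> 0 ->
  (forall (a b : Rbar) (f : R -> R),
     pos_interval a b -> rotational_translator alpha a b f ->
     exists s m : R,
       is_sign s /\ constant_range alpha m /\
       (0 < alpha < 1 / 2 -> 0 < m) /\
       is_profile alpha s m a b f) /\
  (forall s m : R, is_sign s -> constant_range alpha m ->
     (alpha = 1 / 2 -> maximal_domain alpha s m 0 p_infty) /\
     (0 < alpha < 1 / 2 ->
        (0 < m ->
           maximal_domain alpha s m 0 (sqrt (2 * alpha / (1 - 2 * alpha) * m))) /\
        (m <= 0 -> forall a b : Rbar, ~ profile_domain alpha s m a b)) /\
     (~ (0 <= alpha <= 1 / 2) ->
        (0 <= m -> maximal_domain alpha s m 0 p_infty) /\
        (m < 0 ->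
           maximal_domain alpha s m
             (sqrt (2 * alpha / (1 - 2 * alpha) * m)) p_infty))).
Proof.
  intros alpha Ha; split.
  - intros a b f Hab Hf.
    destruct (translator_profile_sign alpha a b f Ha Hab Hf) as [s [Hs Dfs]].
    exists s; destruct (Req_dec alpha (1 / 2)) as [-> | Ha2].
    + destruct (first_integral_half a b f Hab Hf) as [m [Hm E]].
      exists m; split; [ exact Hs | ]; split; [ now intros _ | ]; split; [ lra | ].
      intros r Hr; destruct (Dfs r Hr) as [H1 D].
      exists (Derive f r ^ 2 - 1); split; [ left; auto | ].
      replace (1 + (Derive f r ^ 2 - 1)) with (Derive f r ^ 2) by ring; split; [ lra | exact D ].
    + destruct (first_integral alpha a b f Ha Ha2 Hab Hf) as [m Hm].
      exists m; split; [ exact Hs | ]; split; [ now intros -> | ]; split.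
      * intros Hal; destruct (itv_inhabited a b (proj2 Hab)) as [r Hr].
        destruct (Hm r Hr) as [Hb _].
        apply Rnot_le_lt; intros Hm0; assert (Hb' := base_nonpos alpha m r Hal Hm0); lra.
      * intros r Hr; destruct (Dfs r Hr) as [H1 D], (Hm r Hr) as [Hb E].
        exists (Derive f r ^ 2 - 1); split.
        { right; split; [ exact Ha2 | now apply is_power_of_pos ]. }
        replace (1 + (Derive f r ^ 2 - 1)) with (Derive f r ^ 2) by ring; split; [ lra | exact D ].
  - intros s m Hs Hrange; split; [ | split ].
    + intros ->; split; [ apply profile_domain_half; auto; split; [ apply Rle_refl | easy ] | ].
      (* For alpha = 1/2 the domain is the whole half-line, which already contains every
         [pos_interval]. *)
      intros c d [[Hc _] _]; split; [ exact Hc | now destruct d ].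
    + intros Hal.
      assert (Hj : 0 < 2 * alpha / (1 - 2 * alpha)) by (apply Rdiv_lt_0_compat; lra).
      split.
      * intros Hm.
        assert (Hjm := Rmult_lt_0_compat _ _ Hj Hm).
        assert (Hk : 0 < - ((2 * alpha - 1) / (2 * alpha))).
        { replace (- ((2 * alpha - 1) / (2 * alpha))) with ((1 - 2 * alpha) / (2 * alpha)) by (field; lra).
          apply Rdiv_lt_0_compat; lra. }
        apply maximal_domain_of_base_pos; auto; [ lra | | ].
        { split; [ apply Rle_refl | now apply sqrt_lt_R0 ]. }
        intros r Hr; rewrite base_factor by lra.
        unfold itv; simpl Rbar_lt; rewrite lt_sqrt_iff by lra; split; [ intros [_ H] | intros H; split; [ exact Hr | ] ]; nra.
      * intros Hm a b Hdom.
        destruct (itv_inhabited a b (proj2 (proj1 Hdom))) as [r Hr].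
        assert (Hb : 0 < base alpha m r) by (apply (profile_domain_base_pos alpha s m a b); auto; lra).
        assert (Hb' := base_nonpos alpha m r Hal Hm); lra.
    + intros Hal.
      assert (Ha2 : alpha <> 1 / 2) by lra.
      assert (Hk : 0 < (2 * alpha - 1) / (2 * alpha)).
      { destruct (Rlt_le_dec alpha 0) as [Hneg | Hpos].
        - replace ((2 * alpha - 1) / (2 * alpha)) with ((1 - 2 * alpha) / (2 * - alpha)) by (field; lra).
          apply Rdiv_lt_0_compat; lra.
        - apply Rdiv_lt_0_compat; lra. }
      assert (Hj : 2 * alpha / (1 - 2 * alpha) < 0).
      (* The factor multiplying m in the critical radius is the negative reciprocal of the positive
         coefficient of t^2, so m < 0 makes the radicand positive. *)
      { replace (2 * alpha / (1 - 2 * alpha)) with (- / ((2 * alpha - 1) / (2 * alpha))) by (field; lra).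
        apply Rinv_0_lt_compat in Hk; lra. }
      split; intros Hm; apply maximal_domain_of_base_pos; auto.
      * split; [ apply Rle_refl | easy ].
      * intros r Hr; split; [ intros _ | easy ].
        unfold base; assert (Hr2 : 0 < r ^ 2) by nra.
        assert (H := Rmult_lt_0_compat _ _ Hk Hr2); lra.
      * split; [ apply sqrt_pos | easy ].
      * assert (Hjm : 0 <= 2 * alpha / (1 - 2 * alpha) * m) by nra.
        intros r Hr; rewrite base_factor by lra.
        unfold itv; simpl Rbar_lt; rewrite sqrt_lt_iff by lra.
        split; [ intros [H _] | intros H; split; [ | exact I ] ]; nra.
Qed.
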